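(* Let $w$ be an infinite pin word that contains only finitely many visits. Then $\mathrm{gr}(\mathcal{C}_w)=\kappa\approx 2.20557$, the largest real root of $z^3-2z^2-1$.
   Context: Gridded permutations: a (gridded) permutation is a finite set of points in $\mathbb{R}^2$, no two sharing an $x$- or $y$-coordinate and none on the axes, regarded as equal to another if there is a bijection preserving relative horizontal order, relative vertical order and the quadrant of every point. $\sigma\le\pi$ if some subset of the points of $\pi$ equals $\sigma$. $\mathrm{gr}(\mathcal{C})=\lim_n|\mathcal{C}_n|^{1/n}$, $\mathcal{C}_n$ the elements of length $n$ (this limit exists for pin classes). Pin words: over the alphabet $\{\mathsf{l}_\mathsf{u},\mathsf{l}_\mathsf{d},\mathsf{r}_\mathsf{u},\mathsf{r}_\mathsf{d},\mathsf{u}_\mathsf{l},\mathsf{u}_\mathsf{r},\mathsf{d}_\mathsf{l},\mathsf{d}_\mathsf{r}\}$, a pin word is a word in which each letter $x_y$ that is followed by a letter is followed by some $z_x$ with $z$ perpendicular to $x$. Quadrant of a letter: $\{\mathsf{r},\mathsf{u}\}\mapsto1$ (top-right), $\{\mathsf{l},\mathsf{u}\}\mapsto2$ (top-left), $\{\mathsf{l},\mathsf{d}\}\mapsto3$ (bottom-left), $\{\mathsf{r},\mathsf{d}\}\mapsto4$ (bottom-right). A pin word $w=w_1w_2\cdots$ determines $\pi_w$ with points $p_1,p_2,\ldots$: $p_1$ lies in the quadrant of $w_1$; for $i\ge2$, if $w_i=x_y$ then $p_i$ lies outside the smallest axis-parallel rectangle containing the origin and $p_1,\dots,p_{i-1}$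 on its side in direction $x$, and lies horizontally or vertically strictly between $p_{i-1}$ and the smallest axis-parallel rectangle containing the origin and $p_1,\dots,p_{i-2}$. $\mathcal{C}_w=\{\sigma\text{ finite}:\sigma\le\pi_w\}$. A visit of $w$ to quadrant $q$ is a finite factor $w_{i+1}\cdots w_{i+k}$ ($k\ge1$) all of whose letters have quadrant $q$, such that $w_i$ (if $i\ge1$) and $w_{i+k+1}$ do not have quadrant $q$; a visit is a visit to some quadrant. *)

(* Defs.v *)
From HB Require Import structures.
From mathcomp Require Import all_boot all_order all_algebra finmap.
From mathcomp Require Import all_classical all_reals all_analysis.
From mathcomp Require Import ring lra.

Set Implicit Arguments.
Unset Strict Implicit.
Unset Printing Implicit Defensive.

Import Order.TTheory GRing.Theory Num.Theory.
Import numFieldNormedType.Exports.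

Local Open Scope classical_set_scope.
Local Open Scope ring_scope.

Section GriddedPermutations.
Variable R : realType.
Implicit Types (a b : R * R) (A B S s t : set (R * R)).

Definition in_quadrant (q : nat) a : bool :=
  match q with
  | 1 => (0 < a.1) && (0 < a.2)
  | 2 => (a.1 < 0) && (0 < a.2)
  | 3 => (a.1 < 0) && (a.2 < 0)
  | 4 => (0 < a.1) && (a.2 < 0)
  | _ => false
  end.

Definition gridded_perm A : Prop :=
  [/\ finite_set A,
      forall a, A a -> a.1 != 0 /\ a.2 != 0 &
      forall a b, A a -> A b -> a != b -> a.1 != b.1 /\ a.2 != b.2].

Definition gridded_eq A B : Prop :=
  exists f : R * R -> R * R,
  [/\ set_bij A B f,
      forall a b, A a -> A b -> ((f a).1 < (f b).1) = (a.1 < b.1),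
      forall a b, A a -> A b -> ((f a).2 < (f b).2) = (a.2 < b.2) &
      forall a q, A a -> in_quadrant q (f a) = in_quadrant q a].

Definition contained s A : Prop := exists2 S, S `<=` A & gridded_eq S s.

Definition gridded_class s : set (set (R * R)) :=
  [set t | gridded_perm t /\ gridded_eq s t].

(* A class of gridded permutations is given by all the point sets representing
   its members; [level C n] is the set of its members of length n, each member
   being a full [gridded_eq]-class of point sets. *)
Definition level (C : set (set (R * R))) (n : nat) : set (set (set (R * R))) :=
  gridded_class @` [set s | C s /\ (s #= `I_n)%card].

Definition has_growth_rate (C : set (set (R * R))) (g : R) : Prop :=
  (fun n : nat => (#|` fset_set (level C n)|%fset%:R : R) `^ (n%:R^-1)) @ \oo --> g.

End GriddedPermutations.

Variant direction := Left | Right | Up | Down.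

Definition perpendicular (x y : direction) : bool :=
  match x, y with
  | (Left | Right), (Up | Down) | (Up | Down), (Left | Right) => true
  | _, _ => false
  end.

(* The letter x_y is written with its subscript as second character. *)
Variant letter := Lu | Ld | Ru | Rd | Ul | Ur | Dl | Dr.

Definition dir (c : letter) : direction :=
  match c with
  | Lu | Ld => Left | Ru | Rd => Right | Ul | Ur => Up | Dl | Dr => Down
  end.

Definition sub_dir (c : letter) : direction :=
  match c with
  | Ul | Dl => Left | Ur | Dr => Right | Lu | Ru => Up | Ld | Rd => Down
  end.

Definition quadrant (c : letter) : nat :=
  match c with
  | Ru | Ur => 1 | Lu | Ul => 2 | Ld | Dl => 3 | Rd | Dr => 4
  end.

(* Infinite words are indexed from 0: [w i] is the letter w_{i+1}. *)
Definition infinite_pin_word (w : nat -> letter) : Prop :=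
  forall i, sub_dir (w i.+1) = dir (w i) /\
            perpendicular (dir (w i.+1)) (dir (w i)).

(* The factor w_{i+1} ... w_{i+k}, as an occurrence given by i and k. *)
Definition visit_to (w : nat -> letter) (q i k : nat) : Prop :=
  [/\ (0 < k)%N,
      forall j, (i <= j < i + k)%N -> quadrant (w j) = q,
      (0 < i)%N -> quadrant (w i.-1) <> q &
      quadrant (w (i + k)%N) <> q].

Definition visits (w : nat -> letter) : set (nat * nat) :=
  [set v | exists q, visit_to w q v.1 v.2].

Section PinSequences.
Variable R : realType.
Implicit Types (p : nat -> R * R) (a b : R * R).

(* Sides of the smallest axis-parallel rectangle containing the origin and the
   first n points p 0, ..., p n.-1. *)
Definition rect_left p n : R := \big[Num.min/0]_(j < n) (p j).1.
Definition rect_right p n : R := \big[Num.max/0]_(j < n) (p j).1.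
Definition rect_bottom p n : R := \big[Num.min/0]_(j < n) (p j).2.
Definition rect_top p n : R := \big[Num.max/0]_(j < n) (p j).2.

Definition beyond p n (x : direction) a : bool :=
  match x with
  | Left => a.1 < rect_left p n
  | Right => rect_right p n < a.1
  | Up => rect_top p n < a.2
  | Down => a.2 < rect_bottom p n
  end.

Definition horizontally_between p n b a : bool :=
  (rect_right p n < a.1 < b.1) || (b.1 < a.1 < rect_left p n).

Definition vertically_between p n b a : bool :=
  (rect_top p n < a.2 < b.2) || (b.2 < a.2 < rect_bottom p n).

Definition pin_points (w : nat -> letter) p : Prop :=
  in_quadrant (quadrant (w 0%N)) (p 0%N) /\
  forall i, beyond p i.+1 (dir (w i.+1)) (p i.+1) /\
    (horizontally_between p i (p i) (p i.+1) \/
     vertically_between p i (p i) (p i.+1)).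

Definition pin_class p : set (set (R * R)) :=
  [set s | gridded_perm s /\ contained s (range p)].

(* Every pin word has such a point sequence: put the i-th point at distance
   2 i + 4 in its direction and 2 i + 1 in its subscript direction. *)
Definition coord (x : direction) (r : R) : R * R :=
  match x with
  | Left => (- r, 0) | Right => (r, 0) | Up => (0, r) | Down => (0, - r)
  end.

Definition pin_model (w : nat -> letter) (i : nat) : R * R :=
  coord (dir (w i)) (2 * i%:R + 4) + coord (sub_dir (w i)) (2 * i%:R + 1).

Lemma pin_model_bound w j : [/\ - (2 * j%:R + 4) <= (pin_model w j).1,
  (pin_model w j).1 <= 2 * j%:R + 4, - (2 * j%:R + 4) <= (pin_model w j).2 &
  (pin_model w j).2 <= 2 * j%:R + 4].
Proof.
have j0 : 0 <= j%:R :> R by [].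
by rewrite /pin_model; case: (w j) => /=; split; lra.
Qed.

Lemma pin_model_rect w n : [/\ - (2 * n%:R + 2) <= rect_left (pin_model w) n,
  rect_right (pin_model w) n <= 2 * n%:R + 2,
  - (2 * n%:R + 2) <= rect_bottom (pin_model w) n &
  rect_top (pin_model w) n <= 2 * n%:R + 2].
Proof.
have n0 : 0 <= n%:R :> R by [].
have lejn (j : 'I_n) : j%:R + 1 <= n%:R :> R by rewrite natr1 ler_nat.
split; [apply: le_bigmin => [|j _]|apply: bigmax_le => [|j _]
  |apply: le_bigmin => [|j _]|apply: bigmax_le => [|j _]]; try lra;
  by have [] := pin_model_bound w j; have := lejn j; lra.
Qed.

Lemma pin_points_exist w : infinite_pin_word w -> exists p, pin_points w p.
Proof.
move=> hw; exists (pin_model w); split.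
  by rewrite /pin_model; case: (w 0%N) => /=; apply/andP; split; lra.
move=> i; have [l1 r1 b1 t1] := pin_model_rect w i.
have [l2 r2 b2 t2] := pin_model_rect w i.+1.
have i0 : 0 <= i%:R :> R by [].
move: l2 r2 b2 t2; rewrite -natr1 => l2 r2 b2 t2.
rewrite /beyond /horizontally_between /vertically_between.
have [hs _] := hw i.
have -> : pin_model w i = coord (dir (w i)) (2 * i%:R + 4)
  + coord (sub_dir (w i)) (2 * i%:R + 1) by [].
have -> : pin_model w i.+1 = coord (dir (w i.+1)) (2 * (i%:R + 1) + 4)
  + coord (sub_dir (w i.+1)) (2 * (i%:R + 1) + 1) by rewrite natr1.
by move: hs; case: (w i.+1) => /=; case: (w i) => //= _;
  split; try lra; first [left; apply/orP; left; lra | left; apply/orP; right; lra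
    | right; apply/orP; left; lra | right; apply/orP; right; lra].
Qed.

End PinSequences.

(* Main.v *)
(** From some index M on, the pin word stays in one quadrant, so, up to a
    reflection, the points from M on form an increasing oscillation: distant
    points are ordered in both coordinates like their indices, and neighbours
    form inversions.  The sum-indecomposable patterns of an oscillation are its
    runs of consecutive points: one pattern of each of the lengths 1 and 2, and
    two patterns (according to the parity of the start) of every length at
    least 3.  Hence the patterns of length n of the oscillation correspond to
    words of blocks of total length n, whose number t_n satisfies
    t_(n+3) = 2 t_(n+2) + t_n and is of the order of kappa^n.  A finite set of
    points is a subset of the first M points, then a run starting at M, then a
    part above and beyond these; as there are 2^M such subsets and kappa >= 2,
    summing over the length of the run gives O(kappa^n) patterns altogether. *)

Require Import Defs.
From mathcomp Require Import all_boot all_order all_algebra finmap.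
From mathcomp Require Import all_classical all_reals all_analysis.
From mathcomp Require Import zify ring lra.

Import Order.TTheory GRing.Theory Num.Theory.
Import numFieldNormedType.Exports.

Set Implicit Arguments.
Unset Strict Implicit.
Unset Printing Implicit Defensive.

Local Open Scope classical_set_scope.
Local Open Scope ring_scope.

(** * Block codes *)

(* A code lists the runs of a set of points: (k, b) is a run of length k whose
   first pin is horizontal iff b holds; b is normalised to false when k <= 2,
   where it does not affect the pattern. *)
Definition block_code := seq (nat * bool).

Definition block_ok (kb : nat * bool) : bool :=
  (0 < kb.1)%N && (kb.2 ==> (2 < kb.1)%N).

Definition weight (c : block_code) : nat := sumn (unzip1 c).

Definition grow (c : block_code) : block_code :=
  if c is (k, b) :: c' then (k.+1, b) :: c' else [::].

(* Every admissible code of weight n + 3 arises once: its first block is of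
   size 1, or is the block (3, true), or is obtained by growing a block. *)
Fixpoint codes (n : nat) : seq block_code :=
  match n with
  | 0 => [:: [::]]
  | 1 => [:: [:: (1%N, false)]]
  | 2 => [:: [:: (1%N, false); (1%N, false)]; [:: (2%N, false)]]
  | (((n'.+1) as n1).+1 as n2).+1 =>
      map (cons (1%N, false)) (codes n2) ++ map grow (codes n2) ++
      map (cons (3%N, true)) (codes n')
  end.

Arguments codes : simpl never.

Lemma codesSSS n : codes n.+3 = map (cons (1%N, false)) (codes n.+2) ++
  map grow (codes n.+2) ++ map (cons (3%N, true)) (codes n).
Proof. by []. Qed.

Lemma size_codes n :
  size (codes n.+3) = (2 * size (codes n.+2) + size (codes n))%N.
Proof. by rewrite codesSSS !size_cat !size_map mul2n -addnn addnA. Qed.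

Lemma codes_ind (P : nat -> Prop) : P 0%N -> P 1%N -> P 2%N ->
  (forall n, P n -> P n.+1 -> P n.+2 -> P n.+3) -> forall n, P n.
Proof.
move=> P0 P1 P2 PS n.
suff [] : [/\ P n, P n.+1 & P n.+2] by [].
by elim: n => [|n [h0 h1 h2]]; split=> //; apply: PS.
Qed.

Lemma codes_ok n c : c \in codes n -> all block_ok c /\ weight c = n.
Proof.
elim/codes_ind: n c => [|||n IH0 _ IH2] c.
- by rewrite inE => /eqP->.
- by rewrite inE => /eqP->.
- by rewrite !inE => /orP[] /eqP->.
rewrite codesSSS !mem_cat => /or3P[] /mapP[c'].
- by move=> /IH2[h1 h2] ->; rewrite /= h1 /weight /= -/(weight c') h2.
- case: c' => [/IH2[]//|[k b] c'] /IH2[]; rewrite /weight /block_ok /=.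
  move=> /andP[/andP[k0 bk] ok] <- ->; rewrite /= ok /=; split; last lia.
  by move: bk; case: (b) => //= bk; lia.
- by move=> /IH0[h1 h2] ->; rewrite /= h1 /weight /= -/(weight c') h2.
Qed.

Lemma codes_complete c : all block_ok c -> c \in codes (weight c).
Proof.
move en : (weight c) => n.
elim/codes_ind: n c en => [|||n IH0 _ IH2] [|[k b] c];
  rewrite /weight /block_ok //= -?/(weight c).
- by case: k.
- move=> e /andP[/andP[k0 bk] ok].
  have ek : k = 1%N by lia.
  have ec : weight c = 0%N by lia.
  move: bk; rewrite ek; case: (b) => // _.
  case: c ok ec {e} => [//|[k' b'] c'] /= /andP[/andP[/= k0' _] _].
  by rewrite /weight /=; lia.
- move=> e /andP[/andP[k0 bk] ok].
  have b0 : b = false by move: bk; case: (b) => //=; lia.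
  rewrite b0; case: c ok e => [|[k' b'] c'].
    by move=> _; rewrite /weight /= addn0 => ->.
  rewrite /weight /= -/(weight c') => /andP[/andP[/= k0' bk'] ok'] e.
  have ek : k = 1%N by lia.
  have ek' : k' = 1%N by lia.
  have b0' : b' = false by move: bk'; case: (b') => //=; lia.
  case: c' ok' e => [_ _|[k2 b2] c2 /andP[/andP[/= k02 _] _]].
    by rewrite ek ek' b0'.
  by rewrite /weight /=; lia.
move=> e /andP[/andP[k0 bk] ok].
rewrite !mem_cat; apply/or3P.
have [ek|k1] := eqVneq k 1%N.
  apply: Or31; have -> : b = false by move: bk; rewrite ek; case: (b).
  by rewrite ek map_f // IH2 //; lia.
have [/andP[/eqP k3 b1]|kb] := boolP ((k == 3%N) && b).
  by apply: Or33; rewrite k3 b1 map_f // IH0 //; lia.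
(* The first block now has length at least 2 and is not (3, true), so shortening it by one keeps it
   admissible. *)
apply: Or32; apply/mapP; exists ((k.-1, b) :: c) => /=; last by rewrite prednK.
apply: IH2; first by rewrite /weight /= -/(weight c); lia.
rewrite /= ok andbT /block_ok /=; move: kb bk.
by case: (b) => /= *; lia.
Qed.

(** The first block tells the three families apart: a grown block has length at least 2, and it is
    not (3, true) because (2, true) is inadmissible. *)
Lemma uniq_codes n : uniq (codes n).
Proof.
elim/codes_ind: n => [|||n u0 _ u2] //.
have ne c : c \in codes n.+2 -> c <> [::]
  by move=> h c0; have [_] := codes_ok h; rewrite c0.
rewrite codesSSS !cat_uniq !map_inj_in_uniq //=.
- rewrite u0 u2 !andbT /=; apply/andP; split; apply/hasPn => c.
    rewrite mem_cat => /orP[] /mapP[c'].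
      case: c' => [/ne//|[k b] c'] /codes_ok[/= /andP[+ _] _] ->.
      rewrite /block_ok /= => /andP[k0 _]; apply/negP => /mapP[c2 _ []].
      by lia.
    by move=> _ -> ; apply/negP => /mapP[c2 _].
  move=> /mapP[c' _ ->]; apply/negP => /mapP[[|[k b] c2]]; first by move=> /ne.
  move=> /codes_ok[/= /andP[+ _] _] [ek eb _]; rewrite -ek -eb /block_ok /=.
  by [].
- by move=> c1 c2 _ _ [].
- move=> [|[k b] c1] [|[k' b'] c2]; try by move=> /ne /(_ erefl).
    by move=> _ /ne /(_ erefl).
  by move=> _ _ [-> -> ->].
- by move=> c1 c2 _ _ [].
Qed.

(** * Isomorphism of finite index sequences *)

Section IndexIsomorphism.
Variables (R : realType) (X Y : nat -> R) (q : nat -> nat).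
Implicit Types (s t b : seq nat) (g : nat -> nat).

Definition preserves g s : Prop :=
  [/\ {in s &, forall i j, (X (g i) < X (g j)) = (X i < X j)},
      {in s &, forall i j, (Y (g i) < Y (g j)) = (Y i < Y j)} &
      {in s, forall i, q (g i) = q i}].

(** Lists stand for finite index sets, hence the matching up to permutation. This is the index form
    of equality of gridded permutations. *)
Definition iso s t : Prop := exists2 g, perm_eq (map g s) t & preserves g s.

Definition dom (i j : nat) : bool := (X i < X j) && (Y i < Y j).

Lemma dom_asym i j : dom i j -> dom j i -> False.
Proof. by move=> /andP[h1 _] /andP[h2 _]; move: (lt_trans h1 h2); rewrite ltxx. Qed.

Lemma preserves_dom g s :
  preserves g s -> {in s &, forall i j, dom (g i) (g j) = dom i j}.
Proof. by move=> [hX hY _] i j si sj; rewrite /dom hX // hY. Qed.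

Lemma preserves_sub g s t : {subset s <= t} -> preserves g t -> preserves g s.
Proof.
move=> st [hX hY hq].
by split=> [i j /st ti /st tj|i j /st ti /st tj|i /st ti];
  [exact: hX|exact: hY|exact: hq].
Qed.

Lemma iso_refl s : iso s s.
Proof. by exists id; rewrite ?map_id. Qed.

Lemma iso_size s t : iso s t -> size s = size t.
Proof. by move=> [g /perm_size]; rewrite size_map. Qed.

Lemma iso_perm s s' t : perm_eq s s' -> iso s' t -> iso s t.
Proof.
move=> e [g pg hg]; exists g; first exact: perm_trans (perm_map g e) pg.
by apply: preserves_sub hg => i; rewrite (perm_mem e).
Qed.

Lemma iso_sym s t : uniq s -> uniq t -> iso s t -> iso t s.
Proof.
move=> us ut [g pg hg].
have ug : uniq (map g s) by rewrite (perm_uniq pg).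
have mt i : (i \in t) = (i \in map g s) by rewrite (perm_mem pg).
pose h j := nth 0%N s (index j (map g s)).
have hK : {in s, cancel g h}.
  move=> i si; rewrite /h -[in g i](nth_index 0%N si).
  rewrite -(nth_map 0%N 0%N) ?index_mem //.
  by rewrite index_uniq ?size_map ?index_mem // nth_index.
have hs : map h (map g s) = s.
  by rewrite -map_comp -[RHS]map_id; apply/eq_in_map => i si /=; rewrite hK.
exists h; first by rewrite -[P in perm_eq _ P]hs perm_map // perm_sym.
case: hg => hX hY hq; split=> [i j|i j|i]; rewrite !mt.
- by move=> /mapP[i' si ->] /mapP[j' sj ->]; rewrite !hK // hX.
- by move=> /mapP[i' si ->] /mapP[j' sj ->]; rewrite !hK // hY.
- by move=> /mapP[i' si ->]; rewrite !hK // hq.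
Qed.

(** Both sides are direct sums, so comparisons between the summands are forced and the two
    isomorphisms can be glued. *)
Lemma iso_cat s s' t t' :
  {in s & s', forall i j, dom i j} -> {in t & t', forall i j, dom i j} ->
  iso s t -> iso s' t' -> iso (s ++ s') (t ++ t').
Proof.
move=> ds dt [g pg [hX hY hq]] [g' pg' [hX' hY' hq']].
have disj i : i \in s' -> (i \in s) = false.
  by move=> s'i; apply/negP => si; have := ds i i si s'i; rewrite /dom ltxx.
have gt i : i \in s -> g i \in t by move=> si; rewrite -(perm_mem pg) map_f.
have gt' i : i \in s' -> g' i \in t' by move=> si; rewrite -(perm_mem pg') map_f.
exists (fun i => if i \in s then g i else g' i).
  rewrite map_cat; apply: perm_cat.
    by rewrite (_ : map _ s = map g s) //; apply/eq_in_map => i ->.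
  by rewrite (_ : map _ s' = map g' s') //; apply/eq_in_map => i /disj ->.
split=> [i j|i j|i]; rewrite !mem_cat.
- case: ifP => [si _|_ /= si]; case: ifP => [sj _|_ /= sj]; rewrite ?hX ?hX' //.
    have /andP[-> _] := ds _ _ si sj.
    by have /andP[-> _] := dt _ _ (gt _ si) (gt' _ sj).
  have /andP[/ltW + _] := ds _ _ sj si; rewrite leNgt => /negbTE ->.
  by have /andP[/ltW + _] := dt _ _ (gt _ sj) (gt' _ si); rewrite leNgt => /negbTE ->.
- case: ifP => [si _|_ /= si]; case: ifP => [sj _|_ /= sj]; rewrite ?hY ?hY' //.
    have /andP[_ ->] := ds _ _ si sj.
    by have /andP[_ ->] := dt _ _ (gt _ si) (gt' _ sj).
  have /andP[_ /ltW +] := ds _ _ sj si; rewrite leNgt => /negbTE ->.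
  by have /andP[_ /ltW +] := dt _ _ (gt _ sj) (gt' _ si); rewrite leNgt => /negbTE ->.
- by case: ifP => [si _|_ /= si]; [exact: hq|exact: hq'].
Qed.

(* Sum-indecomposability: no nonempty proper part lies below the rest. *)
Definition indecomposable b : Prop := forall P : pred nat,
  {in b &, forall i j, P i -> ~~ P j -> dom i j} -> has P b -> all P b.

(** The indices of [b] sent into [b'] lie below those sent into [s'], so by indecomposability all or
    none go into [b']. If none did, some element of [b'] would come from [s], and [g] would reverse
    its order with [b]. *)
Lemma iso_head_sub g b s b' s' :
  {in b & s, forall i j, dom i j} -> {in b' & s', forall i j, dom i j} ->
  indecomposable b -> b != [::] -> b' != [::] ->
  perm_eq (map g (b ++ s)) (b' ++ s') -> preserves g (b ++ s) ->
  {subset map g b <= b'}.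
Proof.
move=> d d' ib b0 b0' pg hg.
have hd := preserves_dom hg.
have mg i : i \in b ++ s -> g i \notin b' -> g i \in s'.
  by move=> bs /negbTE nb; have := map_f g bs; rewrite (perm_mem pg) mem_cat nb.
have bl i : i \in b -> i \in b ++ s by rewrite mem_cat => ->.
have sr i : i \in s -> i \in b ++ s by rewrite mem_cat orbC => ->.
suff /allP h : all (fun i => g i \in b') b by move=> j /mapP[i /h ? ->].
apply: ib => [i j bi bj b'i b'j|].
  by rewrite -hd ?bl //; apply: d' => //; apply: mg => //; exact: bl.
apply/negPn/negP => /hasPn none.
case: b' b0' => // k b' _ in d' pg mg none *.
have : k \in map g (b ++ s) by rewrite (perm_mem pg) inE eqxx.
move=> /mapP[a +]; rewrite mem_cat => /orP[ba|sa] ek.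
  by have := none a ba; rewrite -ek inE eqxx.
case: b b0 => // i b _ in d hd mg bl none sr pg hg *.
have bi : i \in i :: b by rewrite inE eqxx.
apply: (@dom_asym (g i) (g a)); first by rewrite (hd _ _ (bl _ bi) (sr _ sa)) d.
by rewrite -ek; apply: d'; rewrite ?inE ?eqxx // mg ?bl // none.
Qed.

(** Uniqueness of the first indecomposable summand: [g] maps [b] into [b'], a backward isomorphism
    maps [b'] into [b], so the sizes agree and [g] restricts to both summands. *)
Lemma iso_cat_cancel b s b' s' :
  uniq (b ++ s) -> uniq (b' ++ s') ->
  {in b & s, forall i j, dom i j} -> {in b' & s', forall i j, dom i j} ->
  indecomposable b -> indecomposable b' -> b != [::] -> b' != [::] ->
  iso (b ++ s) (b' ++ s') -> iso b b' /\ iso s s'.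
Proof.
move=> u u' d d' ib ib' b0 b0' bs.
have [h ph hh] := iso_sym u u' bs; case: bs => g pg hg.
have le (f : nat -> nat) x x' y y' : uniq (x' ++ y') ->
    perm_eq (map f (x ++ y)) (x' ++ y') -> {subset map f x <= x'} ->
    (size x <= size x')%N.
  move=> ux pf /uniq_leq_size; rewrite size_map; apply.
  by move: ux; rewrite -(perm_uniq pf) map_cat cat_uniq => /andP[].
have sg := iso_head_sub d d' ib b0 b0' pg hg.
have sh := iso_head_sub d' d ib' b0' b0 ph hh.
have ug : uniq (map g b).
  by move: u'; rewrite -(perm_uniq pg) map_cat cat_uniq => /andP[].
have pb : perm_eq (map g b) b'.
  apply: uniq_perm => //; first by move: u'; rewrite cat_uniq => /andP[].
  by apply: (uniq_min_size ug sg _).2; rewrite size_map; exact: le u ph sh.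
split; exists g => //.
- by apply: preserves_sub hg => i; rewrite mem_cat => ->.
- rewrite -(perm_cat2l (map g b)) -map_cat.
  by apply: perm_trans pg _; rewrite perm_cat2r perm_sym.
- by apply: preserves_sub hg => i; rewrite mem_cat orbC => ->.
Qed.
End IndexIsomorphism.

(** * Increasing oscillations *)

Section Oscillation.
Variables (R : realType) (X Y : nat -> R) (q : nat -> nat).
Variables (M : nat) (hz : nat -> bool).

(** Here [i] may be an initial index; this places the later blocks above the points before [M]. *)
Hypothesis dom_far : forall i j, (M < j)%N -> (i.+1 < j)%N -> dom X Y i j.
Hypothesis neighbours : forall i, (M <= i)%N ->
  if hz i.+1 then (X i < X i.+1) && (Y i.+1 < Y i)
  else (X i.+1 < X i) && (Y i < Y i.+1).
Hypothesis hzS : forall i, hz i.+1 = ~~ hz i.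
Hypothesis q_const : forall i, (M <= i)%N -> q i = q M.

Local Notation iso := (iso X Y q).
Local Notation dom := (dom X Y).

Lemma hzD i d : hz (i + d) = hz i (+) odd d.
Proof.
elim: d => [|d IH]; first by rewrite addn0 addbF.
by rewrite addnS hzS IH /= addbN.
Qed.

(** [left_of] and [below] compute the two orders on the tail from the indices and the alternation
    [hz]: distant indices keep their order, neighbours keep it only along the axis of the later
    pin. *)
Definition left_of (i j : nat) : bool :=
  [|| (i.+1 < j)%N, (j == i.+1) && hz j | (i == j.+1) && ~~ hz i].

Definition below (i j : nat) : bool :=
  [|| (i.+1 < j)%N, (j == i.+1) && ~~ hz j | (i == j.+1) && hz i].

Lemma coords_lt i j : (M <= i)%N -> (M <= j)%N ->
  (X i < X j) = left_of i j /\ (Y i < Y j) = below i j.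
Proof.
move=> Mi Mj; rewrite /left_of /below.
have far a b : (M <= a)%N -> (a.+1 < b)%N ->
    [/\ X a < X b, Y a < Y b, (X b < X a) = false & (Y b < Y a) = false].
  move=> Ma ab; have /andP[h1 h2] := dom_far (leq_ltn_trans Ma (ltnW ab)) ab.
  by split=> //; apply/negbTE; rewrite -leNgt ltW.
have near a : (M <= a)%N ->
    [/\ (X a < X a.+1) = hz a.+1, (Y a < Y a.+1) = ~~ hz a.+1,
        (X a.+1 < X a) = ~~ hz a.+1 & (Y a.+1 < Y a) = hz a.+1].
  move=> /neighbours; case: (hz a.+1) => /andP[h1 h2];
    by rewrite h1 h2; split=> //; apply/negbTE; rewrite -leNgt ltW.
have SSn a : (a == a.+2) = false by lia.
have Sn a : (a == a.+1) = false by lia.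
case: (ltngtP i j) => [ij|ji|<-].
- case: (ltngtP i.+1 j) ij => [ij' _|//|<- _]; first by have [] := far _ _ Mi ij'.
  by have [-> -> _ _] := near _ Mi; rewrite SSn !orbF.
- have e1 : (i.+1 < j)%N = false by clear -ji; lia.
  have e2 : (j == i.+1) = false by clear -ji; lia.
  rewrite e1 e2 /=; case: (ltngtP j.+1 i) ji {e1 e2} => [ji _|//|e _].
    by have [_ _ -> ->] := far _ _ Mj ji.
  by have [_ _ + +] := near _ Mj; rewrite e => -> ->.
- by rewrite !ltxx Sn (ltnNge i.+1) leqnSn.
Qed.

Lemma X_lt i j : (M <= i)%N -> (M <= j)%N -> (X i < X j) = left_of i j.
Proof. by move=> Mi Mj; have [] := coords_lt Mi Mj. Qed.

Lemma Y_lt i j : (M <= i)%N -> (M <= j)%N -> (Y i < Y j) = below i j.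
Proof. by move=> Mi Mj; have [] := coords_lt Mi Mj. Qed.

(** Neighbours form an inversion, so a set lying below its complement cannot separate them. *)
Lemma iota_indecomposable i k : (M <= i)%N -> indecomposable X Y (iota i k).
Proof.
move=> Mi P hP /hasP[j0 j0i Pj0].
have step j : (i <= j)%N -> (j.+1 < i + k)%N -> P j = P j.+1.
  move=> ij jk; have ji : j \in iota i k by rewrite mem_iota; lia.
  have jSi : j.+1 \in iota i k by rewrite mem_iota; lia.
  have Mj : (M <= j)%N by lia.
  have := neighbours Mj.
  case Pj : (P j); case PSj : (P j.+1) => //.
    have /andP[h1 h2] := hP _ _ ji jSi Pj (negbT PSj).
    by case: ifP => _ /andP[h3 h4];
      [move: (lt_trans h2 h4)|move: (lt_trans h1 h3)]; rewrite ltxx.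
  have /andP[h1 h2] := hP _ _ jSi ji PSj (negbT Pj).
  by case: ifP => _ /andP[h3 h4];
    [move: (lt_trans h1 h3)|move: (lt_trans h2 h4)]; rewrite ltxx.
have all_i d : (d < k)%N -> P (i + d)%N = P i.
  elim: d => [|d IH] dk; first by rewrite addn0.
  by rewrite addnS -step ?IH; lia.
move: j0i; rewrite mem_iota => /andP[ij0 j0k].
have Pi : P i by rewrite -(all_i (j0 - i)%N) ?subnKC //; lia.
apply/allP => j; rewrite mem_iota => /andP[ij jk].
by rewrite -(subnKC ij) all_i //; lia.
Qed.

(** Translation preserves both orders when the first pins have the same orientation. Otherwise there
    are at most two points, and two points form an inversion either way, matched by exchanging
    them. *)
Lemma iota_iso i j k : (M <= i)%N -> (M <= j)%N ->
  (k <= 2)%N || (hz i == hz j) -> iso (iota i k) (iota j k).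
Proof.
move=> Mi Mj; have [hij _|hij] := eqVneq (hz i) (hz j).
  exists (fun a => j + (a - i))%N.
    rewrite (_ : map _ _ = iota j k) //.
    apply: (@eq_from_nth _ 0%N) => [|n]; rewrite size_map !size_iota // => nk.
    by rewrite (nth_map 0%N) ?size_iota // !nth_iota // addKn.
  have hz' a : a \in iota i k -> hz (j + (a - i)) = hz a.
    by rewrite mem_iota => /andP[ia _]; rewrite -{2}(subnKC ia) !hzD hij.
  have Mg a : a \in iota i k -> [/\ (M <= a)%N, (M <= j + (a - i))%N & (i <= a)%N].
    by rewrite mem_iota => /andP[ia _]; split; lia.
  have sh a b : (i <= a)%N -> (i <= b)%N ->
      [/\ ((j + (a - i)).+1 < j + (b - i))%N = (a.+1 < b)%N,
          (j + (b - i) == (j + (a - i)).+1)%N = (b == a.+1) &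
          (j + (a - i) == (j + (b - i)).+1)%N = (a == b.+1)].
    by move=> ia ib; split; lia.
  split=> [a b ha hb|a b ha hb|a /Mg[Ma Ma' _]]; last by rewrite !(q_const (i := _)).
  - have [Ma Ma' ia] := Mg _ ha; have [Mb Mb' ib] := Mg _ hb.
    by have [e1 e2 e3] := sh _ _ ia ib; rewrite !X_lt // /left_of !hz' // e1 e2 e3.
  - have [Ma Ma' ia] := Mg _ ha; have [Mb Mb' ib] := Mg _ hb.
    by have [e1 e2 e3] := sh _ _ ia ib; rewrite !Y_lt // /below !hz' // e1 e2 e3.
rewrite orbF; case: k => [|[|[|//]]] _ /=.
- exact: iso_refl.
- exists (fun=> j) => //; split=> [a b|a b|a]; rewrite !inE.
  + by move=> /eqP-> /eqP->; rewrite !ltxx.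
  + by move=> /eqP-> /eqP->; rewrite !ltxx.
  + by move=> /eqP->; rewrite !q_const.
have hj : hz j = ~~ hz i by move: hij; case: (hz i); case: (hz j).
have SSlt a : (a.+2 < a)%N = false by lia.
have SSn a : (a == a.+2) = false by lia.
have Sn' a : (a.+1 == a) = false by lia.
exists (fun a => if a == i then j.+1 else j).
  by rewrite /= eqxx Sn' (perm_catC [:: j.+1] [:: j]).
split=> [a b|a b|a]; rewrite !inE.
- move=> /orP[] /eqP-> /orP[] /eqP->;
    rewrite ?eqxx ?Sn' ?ltxx // !X_lt ?leqW // /left_of ?hzS ?hj //;
    by rewrite !(SSlt, SSn, ltnn, eqxx, negbK) ?orbF.
- move=> /orP[] /eqP-> /orP[] /eqP->;
    rewrite ?eqxx ?Sn' ?ltxx // !Y_lt ?leqW // /below ?hzS ?hj //;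
    by rewrite !(SSlt, SSn, ltnn, eqxx, negbK) ?orbF.
- by move=> /orP[] /eqP->; rewrite ?eqxx ?Sn' !(q_const (i := _)) ?leqW.
Qed.

(* The leftmost point of a run of length at least three has exactly one point
   of the run below it if the second point is horizontal, and two otherwise. *)
Lemma iota_iso_hz i j k : (M <= i)%N -> (M <= j)%N -> (2 < k)%N ->
  hz i.+1 -> iso (iota i k) (iota j k) -> hz j.+1.
Proof.
move=> Mi Mj k2 hi [g pg [hX hY _]]; apply/negPn/negP => hj.
have pre b : b \in iota j k -> exists2 a, a \in iota i k & g a = b.
  by rewrite -(perm_mem pg) => /mapP[a ia ->]; exists a.
(* If the second pin of the run at [j] is vertical, its leftmost point is [j.+1], with both [j] and
   [j.+2] below it. Their preimages [v] and [x] will both have to be [i.+1]. *)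
have [u iu gu] : exists2 a, a \in iota i k & g a = j.+1.
  by apply: pre; rewrite mem_iota; lia.
have [v iv gv] : exists2 a, a \in iota i k & g a = j.
  by apply: pre; rewrite mem_iota; lia.
have [x ix gx] : exists2 a, a \in iota i k & g a = j.+2.
  by apply: pre; rewrite mem_iota; lia.
have Mk a : a \in iota i k -> (M <= a)%N by rewrite mem_iota; lia.
have ui : u = i.
  have ii : i \in iota i k by rewrite mem_iota; lia.
  have gi : g i \in iota j k by rewrite -(perm_mem pg) map_f.
  have Mgi : (M <= g i)%N by move: gi; rewrite mem_iota; lia.
  have := hX _ _ ii iu; rewrite gu !X_lt ?leqW ?(Mk _ iu) //.
  rewrite /left_of; move: gi iu; rewrite !mem_iota => gi iu.
  have [//|ui] := eqVneq u i.
  have -> : [|| (i.+1 < u)%N, (u == i.+1) && hz u | (i == u.+1) && ~~ hz i].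
    have [->|ui'] := eqVneq u i.+1; first by rewrite hi orbT.
    by apply/orP; left; clear -iu ui ui'; lia.
  case/or3P.
  - by move=> h; exfalso; clear -h gi; lia.
  - by rewrite (negbTE hj) andbF.
  - by move=> /andP[/eqP-> ]; rewrite hzS hj.
subst u.
have below_i a : a \in iota i k -> below a i -> a = i.+1.
  rewrite mem_iota /below => /andP[ia _] /or3P[h|/andP[/eqP h _]|/andP[/eqP//]];
    by exfalso; clear -h ia; lia.
have vi : v = i.+1.
  apply: below_i => //; rewrite -Y_lt ?Mk // -hY // gu gv Y_lt ?leqW //.
  by rewrite /below eqxx hj orbT.
have xi : x = i.+1.
  apply: below_i => //; rewrite -Y_lt ?Mk // -hY // gu gx Y_lt ?leqW //.
  by rewrite /below eqxx (hzS j.+1) hj !orbT.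
by move: gv; rewrite vi -xi gx; clear; lia.
Qed.

(** * Realizing block codes by index sets *)

Definition start (m : nat) (b : bool) : nat := if hz m == b then m else m.+1.

Lemma start_ge m b : (m <= start m b)%N.
Proof. by rewrite /start; case: ifP. Qed.

Lemma hz_start m b : hz (start m b) = b.
Proof.
rewrite /start; case: eqP => // /eqP; rewrite hzS.
by case: (hz m); case: b.
Qed.

(** The extra [.+1] leaves a gap after each block, so that the following blocks dominate it. *)
Fixpoint realize (m : nat) (c : block_code) : seq nat :=
  if c is (k, b) :: c' then
    iota (start m b) k ++ realize (start m b + k).+1 c'
  else [::].

Lemma size_realize m c : size (realize m c) = weight c.
Proof. by elim: c m => [//|[k b] c IH] m /=; rewrite size_cat size_iota IH. Qed.

Lemma realize_ge m c i : i \in realize m c -> (m <= i)%N.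
Proof.
elim: c m => [//|[k b] c IH] m /=; have := start_ge m b.
by rewrite mem_cat mem_iota => mb /orP[|/IH]; lia.
Qed.

Lemma uniq_realize m c : uniq (realize m c).
Proof.
elim: c m => [//|[k b] c IH] m /=; rewrite cat_uniq iota_uniq IH andbT /=.
by apply/hasPn => i /realize_ge; rewrite mem_iota; lia.
Qed.

Lemma iota_dom_realize i k c : (M <= i)%N ->
  {in iota i k & realize (i + k).+1 c, forall a b, dom a b}.
Proof.
move=> Mi a b; rewrite mem_iota => ha /realize_ge hb.
by apply: dom_far; lia.
Qed.

(** Cancel the first blocks and recurse; the remainders may start at different indices, which is why
    [m] and [m'] are independent. Sizes give equal lengths, and [iota_iso_hz], used in both
    directions, gives equal flags. *)
Lemma realize_inj m m' c c' : (M <= m)%N -> (M <= m')%N ->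
  all block_ok c -> all block_ok c' ->
  iso (realize m c) (realize m' c') -> c = c'.
Proof.
elim: c c' m m' => [|[k b] c IH] [|[k' b'] c'] m m' Mm Mm' //.
- move=> _ /= /andP[/andP[/= k0 _] _] /iso_size /=.
  by rewrite size_cat size_iota; lia.
- move=> /= /andP[/andP[/= k0 _] _] _ /iso_size /=.
  by rewrite size_cat size_iota; lia.
move=> /= /andP[/andP[/= k0 kb] ok] /andP[/andP[/= k0' kb'] ok'].
have Ms := leq_trans Mm (start_ge m b); have Ms' := leq_trans Mm' (start_ge m' b').
move=> /iso_cat_cancel[].
- exact: (uniq_realize m ((k, b) :: c)).
- exact: (uniq_realize m' ((k', b') :: c')).
- exact: iota_dom_realize.
- exact: iota_dom_realize.
- exact: iota_indecomposable.
- exact: iota_indecomposable.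
- by case: (k) k0.
- by case: (k') k0'.
move=> ik ic; have ek : k = k' by have := iso_size ik; rewrite !size_iota.
rewrite (IH c' _ _ _ _ ok ok' ic); try lia.
rewrite -{}ek in kb' ik *; congr ((_, _) :: _).
case: (leqP k 2) => k2.
  by move: kb kb'; rewrite leqNgt in k2; case: (b) (b') => [] [] //= *; lia.
apply/idP/idP => hb.
- apply/negPn/negP => hb'.
  have := iota_iso_hz Ms' Ms k2 _ (iso_sym (iota_uniq _ _) (iota_uniq _ _) ik).
  by rewrite !hzS !hz_start hb hb' => /(_ isT).
- apply/negPn/negP => hb'.
  by have := iota_iso_hz Ms Ms' k2 _ ik; rewrite !hzS !hz_start hb hb' => /(_ isT).
Qed.

(** [k] is the length of the maximal run from [m], zero if [m] is absent; the strict bound records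
    the gap at [m + k]. *)
Lemma sorted_run m s : sorted ltn s -> all (leq m) s ->
  exists k s', s = iota m k ++ s' /\ all (ltn (m + k)) s'.
Proof.
elim: s m => [|a s IH] m /=; first by exists 0%N, [::].
rewrite (path_sortedE ltn_trans) => /andP[as_ ss] /andP[ma ms].
have [<-|am] := eqVneq m a; last first.
  exists 0%N, (a :: s); split => //; apply/allP => x.
  by rewrite inE => /orP[/eqP->|/(allP as_) /=] /=; lia.
have [|k [s' [-> hs']]] := IH m.+1 ss; first by apply/allP => x /(allP as_) /=; lia.
exists k.+1, s'; split => //.
by apply/allP => x /(allP hs') /=; lia.
Qed.

(** Cut [s] into maximal runs, move each to the first free index of the right orientation, and glue:
    the gaps make later runs dominate earlier ones on both sides. *)
Lemma iso_realize s m : sorted ltn s -> all (leq M) s -> (M <= m)%N ->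
  exists2 c, all block_ok c /\ weight c = size s & iso s (realize m c).
Proof.
have [n] := ubnP (size s); elim: n s m => // n IH [|i s] m sn ss Ms Mm.
  by exists [::] => //; exact: iso_refl.
have Mi : (M <= i)%N by move: Ms => /= /andP[].
have ge_i : all (leq i) (i :: s).
  by move: ss; rewrite /= leqnn (path_sortedE ltn_trans) => /andP[/allP h _];
    apply/allP => x /h; exact: ltnW.
have [k [s' [es hs']]] := sorted_run ss ge_i.
case: k es hs' => [/= <- /=|k es hs']; first by lia.
rewrite es in ss Ms sn *.
(* The block has length [k.+1], so blocks of length 1 and 2 get the normalised flag. *)
pose b := (1 < k)%N && hz i.
have Ms0 := leq_trans Mm (start_ge m b).
have [||||c [ok wc] ic] := IH s' (start m b + k.+1).+1.
- by move: sn; rewrite size_cat size_iota /=; lia.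
- by have [] := cat_sorted2 ss.
- by apply/allP => x /(allP hs') /=; lia.
- by lia.
exists ((k.+1, b) :: c).
  split; first by rewrite /= ok andbT /block_ok /=; apply/implyP => /andP[].
  by rewrite /weight /= -/(weight c) wc size_cat size_iota.
apply: iso_cat => //.
- move=> a a'; rewrite mem_iota => ha /(allP hs') /= ha'.
  by apply: dom_far; lia.
- exact: iota_dom_realize.
- apply: iota_iso => //; rewrite hz_start /b.
  by rewrite leqNgt ltnS; case: (1 < k)%N => /=; rewrite ?eqxx.
Qed.
(** The mask [m] selects among the first [M] indices. The run from [M] stays in place, since the
    point [M] need not dominate the initial ones; only what follows the next gap is normalised. *)
Definition head_tail (m : M.-tuple bool) (k : nat) (c : block_code) : seq nat :=
  (mask m (iota 0 M) ++ iota M k) ++ realize (M + k).+1 c.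

Lemma iso_head_tail s : sorted ltn s -> exists (m : M.-tuple bool) k c,
  [/\ (k <= size s)%N, c \in codes (size s - size (mask m (iota 0 M)) - k) &
      iso s (head_tail m k c)].
Proof.
move=> ss; pose s0 := [seq i <- iota 0 M | i \in s].
pose s1 := [seq i <- s | (M <= i)%N].
have us : uniq s := sorted_uniq ltn_trans ltnn ss.
have ps : perm_eq s (s0 ++ s1).
  apply: uniq_perm => //.
    rewrite cat_uniq !filter_uniq ?iota_uniq // andbT /=.
    by apply/hasPn => i; rewrite !mem_filter mem_iota => /andP[]; lia.
  move=> i; rewrite mem_cat !mem_filter mem_iota add0n leq0n /=.
  by rewrite andbC -andb_orl ltnNge orNb.
have ss1 : sorted ltn s1 by apply: sorted_filter => //; exact: ltn_trans.
have Ms1 : all (leq M) s1 by apply/allP => i; rewrite mem_filter => /andP[].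
have [k [s' [es1 hs']]] := sorted_run ss1 Ms1.
have ss' : sorted ltn s' by rewrite es1 in ss1; have [] := cat_sorted2 ss1.
have Ms' : all (leq M) s' by apply/allP => i /(allP hs') /=; lia.
have [|c [ok wc] ic] := iso_realize (m := (M + k).+1) ss' Ms'; first by lia.
have sz : size (map (fun i => i \in s) (iota 0 M)) == M by rewrite size_map size_iota.
have szs : size s = (size s0 + (k + size s'))%N.
  by rewrite (perm_size ps) es1 !size_cat size_iota.
exists (Tuple sz), k, c; rewrite /head_tail /= -filter_mask -/s0; split.
- by rewrite szs; lia.
- rewrite (_ : (size s - size s0 - k)%N = weight c) ?codes_complete //.
  by rewrite wc szs; lia.
apply: iso_perm ps _; rewrite es1 catA; apply: iso_cat ic.
- move=> i j; rewrite mem_cat mem_filter !mem_iota => hi /(allP hs') /= hj.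
  by apply: dom_far; lia.
- move=> i j; rewrite mem_cat mem_filter !mem_iota => hi /realize_ge hj.
  by apply: dom_far; lia.
- exact: iso_refl.
Qed.

(** An enumeration for the upper bound: it may repeat patterns, and truncated subtraction may add
    lists longer than [n]. *)
Definition head_tails (n : nat) : seq (seq nat) :=
  flatten [seq flatten [seq map (head_tail m k)
                              (codes (n - size (mask m (iota 0 M)) - k))
                       | k <- iota 0 n.+1]
          | m <- enum {: M.-tuple bool}].

Lemma head_tails_complete s : sorted ltn s ->
  exists2 t, t \in head_tails (size s) & iso s t.
Proof.
move=> /iso_head_tail[m [k [c [ks cc sc]]]]; exists (head_tail m k c) => //.
apply/flatten_mapP; exists m; first by rewrite mem_enum.
apply/flatten_mapP; exists k; first by rewrite mem_iota; lia.
exact: map_f.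
Qed.
End Oscillation.

(** * Growth of the number of codes *)

Section Growth.
Variables (R : realType) (kappa : R).
Hypotheses (kappa_root : kappa ^+ 3 = 2 * kappa ^+ 2 + 1)
           (kappa_bounds : 2 <= kappa <= 3).

Let kappa_ge2 : 2 <= kappa. Proof. by case/andP: kappa_bounds. Qed.
Let kappa_le3 : kappa <= 3. Proof. by case/andP: kappa_bounds. Qed.

(** The powers of [kappa] satisfy the recurrence of [size_codes], and the initial values 1, 1, 2 are
    at most 1, [kappa], [kappa ^+ 2]. *)
Lemma size_codes_le n : (size (codes n))%:R <= kappa ^+ n.
Proof.
have k2 := kappa_ge2.
elim/codes_ind: n => [|||n h0 _ h2]; first by rewrite expr0.
- by rewrite expr1 /=; lra.
- by rewrite /=; nra.
rewrite size_codes natrD natrM -addn3 exprD kappa_root.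
rewrite -addn2 exprD in h2 *.
nra.
Qed.

(** The same recurrence from below; as [kappa <= 3], the factor 11 amply covers the three initial
    values. *)
Lemma size_codes_ge n : kappa ^+ n <= 11 * (size (codes n))%:R.
Proof.
have k2 := kappa_ge2; have k3 := kappa_le3.
elim/codes_ind: n => [|||n h0 _ h2]; first by rewrite expr0 /=; lra.
- by rewrite expr1 /=; lra.
- by rewrite /=; nra.
rewrite size_codes natrD natrM -[in X in X <= _]addn3 exprD kappa_root.
rewrite -[in X in X <= _]addn2 exprD in h2.
nra.
Qed.

(** A geometric sum of ratio at least 2 is at most twice its largest term, hence at most [kappa]
    times it. *)
Lemma sum_expr_le n : \sum_(0 <= k < n.+1) kappa ^+ (n - k) <= kappa ^+ n.+1.
Proof.
have k2 := kappa_ge2.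
elim: n => [|n IH]; first by rewrite big_nat1 subnn expr0 expr1; lra.
rewrite big_nat_recl // subn0; under eq_bigr do rewrite subSS.
rewrite [X in _ <= X]exprS.
have : 0 <= kappa ^+ n.+1 by rewrite exprn_ge0 //; lra.
by nra.
Qed.

Lemma size_flatten_map (T U : Type) (F : T -> seq U) s :
  size (flatten (map F s)) = (\sum_(x <- s) size (F x))%N.
Proof. by rewrite size_flatten /shape -map_comp sumnE big_map. Qed.

Lemma size_head_tails_le M hz n :
  (size (head_tails M hz n))%:R <= #|{: M.-tuple bool}|%:R * kappa ^+ n.+1.
Proof.
have k2 := kappa_ge2.
have -> : #|{: M.-tuple bool}|%:R * kappa ^+ n.+1 =
    \sum_(m <- enum {: M.-tuple bool}) kappa ^+ n.+1.
  by rewrite big_const_seq count_predT iter_addr_0 mulr_natl cardE.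
rewrite size_flatten_map natr_sum.
apply: ler_sum => m _; rewrite size_flatten_map natr_sum.
apply: le_trans (sum_expr_le n); apply: ler_sum => k _; rewrite size_map.
apply: le_trans (size_codes_le _) _; apply: ler_weXn2l; first by lra.
by rewrite leq_sub2r ?leq_subr.
Qed.
End Growth.

(** * Geometry of pin sequences *)

Section PinGeometry.
Variables (R : realType) (w : nat -> letter) (p : nat -> R * R).
Hypotheses (hw : infinite_pin_word w) (hp : pin_points w p).

(** A signed coordinate, so that the same inequalities serve all four directions. *)
Definition along (x : direction) (a : R * R) : R :=
  match x with Left => - a.1 | Right => a.1 | Up => a.2 | Down => - a.2 end.

Lemma rect_ge0 n : [/\ rect_left p n <= 0, 0 <= rect_right p n,
  rect_bottom p n <= 0 & 0 <= rect_top p n].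
Proof.
by split; rewrite /rect_left /rect_right /rect_bottom /rect_top;
  [exact: bigmin_le_id|exact: bigmax_ge_id|exact: bigmin_le_id|exact: bigmax_ge_id].
Qed.

Lemma rect_bounds n j : (j < n)%N ->
  [/\ rect_left p n <= (p j).1, (p j).1 <= rect_right p n,
      rect_bottom p n <= (p j).2 & (p j).2 <= rect_top p n].
Proof.
move=> jn; split.
- exact: (bigmin_le _ (Ordinal jn) (fun i : 'I_n => (p i).1)).
- exact: (le_bigmax _ (fun i : 'I_n => (p i).1) (Ordinal jn)).
- exact: (bigmin_le _ (Ordinal jn) (fun i : 'I_n => (p i).2)).
- exact: (le_bigmax _ (fun i : 'I_n => (p i).2) (Ordinal jn)).
Qed.

Lemma along_dir_gt i j : (j <= i)%N ->
  along (dir (w i.+1)) (p j) < along (dir (w i.+1)) (p i.+1).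
Proof.
move=> ji; have [_ /(_ i)[+ _]] := hp.
have [h1 h2 h3 h4] := @rect_bounds i.+1 j ji.
by rewrite /beyond /along; case: (dir _); lra.
Qed.

Lemma along_dir_gt0 i : 0 < along (dir (w i)) (p i).
Proof.
case: i => [|i].
  by case: hp => + _; case: (w 0%N) => /= /andP[]; lra.
have [_ /(_ i)[+ _]] := hp; have [h1 h2 h3 h4] := rect_ge0 i.+1.
by rewrite /beyond /along; case: (dir _); lra.
Qed.

(** The betweenness must be along the axis of the previous pin, since on the other axis [p i.+1] is
    already beyond [p i]. Its side is that of [p i], because [sub_dir (w i.+1) = dir (w i)]. *)
Lemma along_sub i : [/\ 0 < along (sub_dir (w i.+1)) (p i.+1),
  along (sub_dir (w i.+1)) (p i.+1) < along (sub_dir (w i.+1)) (p i) &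
  forall j, (j < i)%N ->
    along (sub_dir (w i.+1)) (p j) < along (sub_dir (w i.+1)) (p i.+1)].
Proof.
have gt0 := along_dir_gt0 i; have [sd pd] := hw i.
have gti := along_dir_gt (leqnn i); have gt0S := along_dir_gt0 i.+1.
have rij j : (j < i)%N -> _ := @rect_bounds i j.
have [h1 h2 h3 h4] := rect_ge0 i.
have [_ /(_ i)[_]] := hp.
rewrite -{}sd in gt0 pd; move: gt0 gti gt0S pd.
rewrite /horizontally_between /vertically_between /along.
case: (w i.+1) => /= gt0 gti gt0S _ [] /orP[] /andP[b1 b2]; try lra;
  by split; try lra; move=> j /rij[]; lra.
Qed.

Lemma in_quadrant_pin i : in_quadrant (quadrant (w i)) (p i).
Proof.
case: i => [|i]; first by case: hp.
have := along_dir_gt0 i.+1; have [+ _ _] := along_sub i.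
by rewrite /along; case: (w i.+1) => /= h1 h2; apply/andP; split; lra.
Qed.

(** The later point exceeds all earlier ones in its direction; in its subscript direction it falls
    short of its predecessor and exceeds the others. *)
Lemma pin_coords_neq i j : i != j -> (p i).1 != (p j).1 /\ (p i).2 != (p j).2.
Proof.
wlog ij : i j / (i < j)%N.
  move=> h; rewrite neq_ltn => /orP[ij|ji].
    by apply: h => //; rewrite neq_ltn ij.
  by rewrite eq_sym (eq_sym (p i).2); apply: h => //; rewrite neq_ltn ji.
move=> _; case: j ij => // j ij.
have := @along_dir_gt j i ij; have [_ h1 h2] := along_sub j.
have : along (sub_dir (w j.+1)) (p i) != along (sub_dir (w j.+1)) (p j.+1).
  move: ij; rewrite ltnS leq_eqVlt => /orP[/eqP->|/h2]; first by rewrite gt_eqF.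
  by move=> h; rewrite lt_eqF.
rewrite /along => {h1 h2}.
by case: (w j.+1) => /=; rewrite ?eqr_opp ?ltrN2 => h1 h2; split=> //;
  rewrite neq_lt h2 ?orbT.
Qed.

Lemma pin_inj : injective p.
Proof.
move=> i j e; apply/eqP/negPn/negP => /pin_coords_neq[].
by rewrite e eqxx.
Qed.

Definition is_horizontal (x : direction) : bool :=
  match x with Left | Right => true | _ => false end.

Lemma horizontalS i : is_horizontal (dir (w i.+1)) = ~~ is_horizontal (dir (w i)).
Proof. by have [_] := hw i; case: (dir _); case: (dir _). Qed.
End PinGeometry.

(** Let [B] bound the starts of visits. After a change of quadrant at or after [B] there is no
    further one, as the stretch up to the next change would be a visit starting beyond [B]. The
    infinite final stay is not a visit. *)
Lemma eventually_const_quadrant (w : nat -> letter) :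
  finite_set (visits w) ->
  exists M, forall i, (M <= i)%N -> quadrant (w i) = quadrant (w M).
Proof.
move=> /(finite_image fst)/finite_seqP[s es].
pose B := (\max_(i <- s) i)%N.
have visit_le i k q : visit_to w q i k -> (i <= B)%N.
  move=> v; have : [set` s] i by rewrite -es; exists (i, k) => //; exists q.
  by move=> si; apply: (@leq_bigmax_seq _ s xpredT id i).
pose change i := quadrant (w i.+1) != quadrant (w i).
have no_change M : ~ (exists i, (M <= i)%N && change i) ->
    forall i, (M <= i)%N -> quadrant (w i) = quadrant (w M).
  move=> nc i Mi; rewrite -(subnKC Mi); elim: (i - M)%N => [|d IH].
    by rewrite addn0.
  rewrite addnS -IH; apply/eqP/negPn/negP => ch; apply: nc.
  by exists (M + d)%N; rewrite leq_addr.
have [/no_change h|] := pselect (~ exists i, (B <= i)%N && change i).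
  by exists B.
move=> /contrapT[i /andP[Bi ci]].
exists i.+1; apply: no_change => ex.
case: (ex_minnP ex) => j /andP[ij cj] jmin.
suff /visit_le : visit_to w (quadrant (w i.+1)) i.+1 (j - i) by lia.
have const d : (i.+1 + d <= j)%N -> quadrant (w (i.+1 + d)%N) = quadrant (w i.+1).
  elim: d => [|d IH] dj; first by rewrite addn0.
  rewrite addnS -IH; last by lia.
  apply/eqP/negPn/negP => ch; have := jmin (i.+1 + d)%N.
  by rewrite leq_addr /= => /(_ ch); lia.
split.
- by lia.
- by move=> l hl; rewrite -(@subnKC i.+1 l) ?const //; lia.
- by move=> _ /= e; move: ci; rewrite /change e eqxx.
- have -> : (i.+1 + (j - i))%N = j.+1 by lia.
  have := const (j - i.+1)%N; rewrite subnKC // leqnn => /(_ isT) ej e.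
  by move: cj; rewrite /change e ej eqxx.
Qed.

(** * Equality of gridded permutations *)

Section GriddedEquality.
Variable R : realType.
Implicit Types A B C : set (R * R).

Lemma gridded_eq_refl A : gridded_eq A A.
Proof. by exists id; split=> //; split=> // a Aa; exists a. Qed.

Lemma gridded_eq_trans A B C : gridded_eq A B -> gridded_eq B C -> gridded_eq A C.
Proof.
move=> [f [bf f1 f2 fq]] [g [bg g1 g2 gq]]; exists (g \o f).
have fB a : A a -> B (f a) by case: bf => + _ _; apply.
split=> [|a b Aa Ab|a b Aa Ab|a q Aa]; first exact: set_bij_comp bg.
- by rewrite /= g1 ?f1 //; exact: fB.
- by rewrite /= g2 ?f2 //; exact: fB.
- by rewrite /= gq ?fq //; exact: fB.
Qed.

Lemma gridded_eq_sym A B : gridded_eq A B -> gridded_eq B A.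
Proof.
move=> [f [[fB fi fs] f1 f2 fq]].
have pre b : exists a, B b -> A a /\ f a = b.
  have [Bb|nB] := pselect (B b); last by exists 0.
  by have [a Aa <-] := fs b Bb; exists a.
have [g gP] := choice pre.
have gA b : B b -> A (g b) by move=> /gP[].
have gK b : B b -> f (g b) = b by move=> /gP[].
exists g; split=> [|a b Ba Bb|a b Ba Bb|a q Ba].
- split=> [b /gA//|a b|a Aa].
    by rewrite !inE => Ba Bb e; rewrite -(gK _ Ba) -(gK _ Bb) e.
  have Bfa := fB _ Aa; exists (f a) => //.
  by apply: fi; rewrite ?inE ?gK //; exact: gA.
- by rewrite -f1 ?gK //; exact: gA.
- by rewrite -f2 ?gK //; exact: gA.
- by rewrite -fq ?gK //; exact: gA.
Qed.

Lemma gridded_class_eq A B :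
  gridded_eq A B -> gridded_class A = gridded_class B.
Proof.
move=> AB; apply/seteqP; split=> C [gC e]; split=> //.
  exact: gridded_eq_trans (gridded_eq_sym AB) e.
exact: gridded_eq_trans e.
Qed.

Lemma gridded_class_inj A B : gridded_perm B ->
  gridded_class A = gridded_class B -> gridded_eq A B.
Proof.
move=> gB e; have : gridded_class A B; last by case.
by rewrite e; split=> //; exact: gridded_eq_refl.
Qed.
End GriddedEquality.

(** * The tail of a pin sequence as an oscillation *)

Definition hdir (c : letter) : direction :=
  match c with Lu | Ld | Ul | Dl => Left | _ => Right end.

Definition vdir (c : letter) : direction :=
  match c with Lu | Ru | Ul | Ur => Up | _ => Down end.

(** Unlike [dir] and [sub_dir], these directions depend on the quadrant only, so they are constant
    along the tail. *)
Lemma quadrant_dirs c c' :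
  quadrant c = quadrant c' -> hdir c = hdir c' /\ vdir c = vdir c'.
Proof. by case: c; case: c'. Qed.

Lemma hdir_vdirE c :
  if is_horizontal (dir c) then dir c = hdir c /\ sub_dir c = vdir c
  else dir c = vdir c /\ sub_dir c = hdir c.
Proof. by case: c. Qed.

Section PinTail.
Variables (R : realType) (w : nat -> letter) (p : nat -> R * R) (M : nat).
Hypotheses (hw : infinite_pin_word w) (hp : pin_points w p).
Hypothesis q_const : forall i, (M <= i)%N -> quadrant (w i) = quadrant (w M).

(* Coordinates after the reflection taking the final quadrant to the first. *)
Let X i : R := along (hdir (w M)) (p i).
Let Y i : R := along (vdir (w M)) (p i).
Let q i := quadrant (w i).
Let hz i := is_horizontal (dir (w i)).
Local Notation iso := (iso X Y q).

Let tail_dirs i : (M <= i)%N ->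
  if hz i then dir (w i) = hdir (w M) /\ sub_dir (w i) = vdir (w M)
  else dir (w i) = vdir (w M) /\ sub_dir (w i) = hdir (w M).
Proof.
move=> Mi; have [<- <-] := quadrant_dirs (q_const Mi); exact: hdir_vdirE.
Qed.

(** Direction and subscript of a tail letter are, in some order, the two sides of the final
    quadrant, so [along_dir_gt] and [along_sub] give one inequality each. *)
Lemma tail_dom_far i j : (M < j)%N -> (i.+1 < j)%N -> dom X Y i j.
Proof.
case: j => // j Mj ij; rewrite /dom /X /Y.
have := tail_dirs (ltnW Mj).
have h := @along_dir_gt _ _ _ hp j i (@ltnW i j ij).
have [_ _ /(_ i ij) h'] := along_sub hw hp j.
by case: (hz _) => -[e1 e2]; rewrite -e1 -e2 h h'.
Qed.

Lemma tail_neighbours i : (M <= i)%N ->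
  if hz i.+1 then (X i < X i.+1) && (Y i.+1 < Y i)
  else (X i.+1 < X i) && (Y i < Y i.+1).
Proof.
move=> Mi; rewrite /X /Y; have := tail_dirs (leqW Mi).
have h := along_dir_gt hp (leqnn i); have [_ h' _] := along_sub hw hp i.
by case: (hz _) => -[e1 e2]; rewrite -e1 -e2 h h'.
Qed.

Lemma in_quadrantE k i : in_quadrant k (p i) = (k == quadrant (w i)).
Proof.
apply/idP/eqP => [|->]; last exact: in_quadrant_pin.
have := in_quadrant_pin hw hp i.
by case: (w i) => /= /andP[h1 h2]; case: k => [|[|[|[|[|k]]]]] //= /andP[h3 h4];
  exfalso; lra.
Qed.

Definition points (s : seq nat) : set (R * R) := p @` [set` s].

Lemma points_gridded_perm s : gridded_perm (points s).
Proof.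
split=> [|_ [i _ <-]|_ _ [i _ <-] [j _ <-] ij].
- exact: finite_image.
- by have := in_quadrant_pin hw hp i; case: (w i) => /= /andP[h1 h2];
    rewrite ?(lt_eqF h1) ?(lt_eqF h2) ?(gt_eqF h1) ?(gt_eqF h2).
- by apply: (pin_coords_neq hw hp); apply: contraNneq ij => ->.
Qed.

(** A left inverse of [p] turns maps between indices into maps between points, and back. *)
Let pK : exists pi, cancel p pi.
Proof.
have pre a : exists i, forall j, p j = a -> i = j.
  have [[i pi]|n] := pselect (exists i, p i = a).
    by exists i => j; rewrite -pi => /(pin_inj hw hp).
  by exists 0%N => j pj; case: n; exists j.
by have [pi h] := choice pre; exists pi => i; exact: h.
Qed.

(** [X] is the first coordinate or its negative, so a comparison may come out reversed; hence both
    are assumed, here and in the next three lemmas. *)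
Lemma lt_fst i j i' j' : (X i < X j) = (X i' < X j') ->
  (X j < X i) = (X j' < X i') ->
  ((p i).1 < (p j).1) = ((p i').1 < (p j').1).
Proof. by rewrite /X /along; case: (w M) => /=; rewrite ?ltrN2. Qed.

Lemma lt_snd i j i' j' : (Y i < Y j) = (Y i' < Y j') ->
  (Y j < Y i) = (Y j' < Y i') ->
  ((p i).2 < (p j).2) = ((p i').2 < (p j').2).
Proof. by rewrite /Y /along; case: (w M) => /=; rewrite ?ltrN2. Qed.

Lemma lt_X i j i' j' : ((p i).1 < (p j).1) = ((p i').1 < (p j').1) ->
  ((p j).1 < (p i).1) = ((p j').1 < (p i').1) ->
  (X i < X j) = (X i' < X j').
Proof. by rewrite /X /along; case: (w M) => /=; rewrite ?ltrN2. Qed.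

Lemma lt_Y i j i' j' : ((p i).2 < (p j).2) = ((p i').2 < (p j').2) ->
  ((p j).2 < (p i).2) = ((p j').2 < (p i').2) ->
  (Y i < Y j) = (Y i' < Y j').
Proof. by rewrite /Y /along; case: (w M) => /=; rewrite ?ltrN2. Qed.

Lemma iso_gridded_eq s t : iso s t -> gridded_eq (points s) (points t).
Proof.
move=> [g pg [gX gY gq]]; have [pi piK] := pK.
have mt i : i \in s -> g i \in t by move=> si; rewrite -(perm_mem pg) map_f.
(* Injectivity comes from preserving strict order, as distinct indices have distinct coordinates. *)
have gi : {in s &, injective g}.
  move=> i j si sj e; apply/eqP/negPn/negP => /(pin_coords_neq hw hp)[+ _].
  rewrite neq_lt -(lt_fst (gX _ _ si sj) (gX _ _ sj si)).
  by rewrite -(lt_fst (gX _ _ sj si) (gX _ _ si sj)) e !ltxx.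
exists (fun a => p (g (pi a))); split.
- split=> [_ [i /= si <-]|a b|_ [j /= tj <-]].
  + by rewrite piK; exists (g i) => //=; exact: mt.
  + rewrite !inE => -[i /= si <-] [j /= sj <-]; rewrite !piK.
    by move=> /(pin_inj hw hp)/gi -> .
  + move: tj; rewrite -(perm_mem pg) => /mapP[i si ->].
    by exists (p i); [exists i|rewrite piK].
- by move=> _ _ [i /= si <-] [j /= sj <-]; rewrite !piK; apply: lt_fst; exact: gX.
- by move=> _ _ [i /= si <-] [j /= sj <-]; rewrite !piK; apply: lt_snd; exact: gY.
- by move=> _ k [i /= si <-]; rewrite piK !in_quadrantE [quadrant _]gq.
Qed.

Lemma gridded_eq_iso s t : uniq s -> uniq t ->
  gridded_eq (points s) (points t) -> iso s t.
Proof.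
move=> us ut [f [[fS fi fs] f1 f2 fq]]; have [pi piK] := pK.
have fp i : i \in s -> p (pi (f (p i))) = f (p i) /\ pi (f (p i)) \in t.
  move=> si; have [|j /= tj <-] := fS (p i); first by exists i.
  by rewrite piK.
have ps i : i \in s -> points s (p i) by move=> si; exists i.
exists (fun i => pi (f (p i))).
  apply: uniq_perm => //.
    rewrite map_inj_in_uniq // => i j si sj e.
    apply: (pin_inj hw hp); apply: fi; rewrite ?inE; try exact: ps.
    by have [<- _] := fp _ si; have [<- _] := fp _ sj; rewrite e.
  move=> j; apply/mapP/idP => [[i si ->]|tj]; first by have [] := fp _ si.
  have [|_ [i /= si <-] e] := fs (p j); first by exists j.
  by exists i => //; rewrite e piK.
split=> [i j si sj|i j si sj|i si].
- have [ei _] := fp _ si; have [ej _] := fp _ sj.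
  by apply: lt_X; rewrite ei ej f1 //; exact: ps.
- have [ei _] := fp _ si; have [ej _] := fp _ sj.
  by apply: lt_Y; rewrite ei ej f2 //; exact: ps.
- have [ei _] := fp _ si; have := in_quadrant_pin hw hp (pi (f (p i))).
  by rewrite ei (fq _ _ (ps _ si)) in_quadrantE => /eqP.
Qed.

(** * Counting the levels of a pin class *)

Lemma card_points s : uniq s -> (points s #= `I_(size s))%card.
Proof.
move=> us; apply: (@card_eq_trans _ _ _ _ [set` s]).
  by apply: inj_card_eq => i j _ _; exact: pin_inj hw hp _ _.
have -> : [set` s] = [set` seq_fset tt s].
  by apply/seteqP; split=> i; rewrite /mkset seq_fsetE.
by apply/card_eq_fsetP; rewrite size_seq_fset undup_id.
Qed.

(** A member equals some set of pin points, which is recovered from its indices in increasing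
    order. *)
Lemma level_pin_class n C : level (pin_class p) n C ->
  exists2 s, sorted ltn s /\ size s = n & C = gridded_class (points s).
Proof.
move=> [A [[gA [S Sp SA]] cA] <-].
have cS : (S #= `I_n)%card.
  apply: card_eq_trans cA; have [f [bf _ _ _]] := SA.
  by apply/card_set_bijP; exists f.
have eS : S = p @` (p @^-1` S).
  apply/seteqP; split=> [a Sa|_ [i Si <-]//].
  by have [i _ e] := Sp _ Sa; exists i => //=; rewrite e.
have cI : (p @^-1` S #= `I_n)%card.
  rewrite eS in cS; apply: card_eq_trans cS; rewrite card_eq_sym.
  by apply: inj_card_eq => i j _ _; exact: (pin_inj hw hp).
have /finite_fsetP[F eF] : finite_set (p @^-1` S) by exists n.
exists (sort leq F).
  split.
    rewrite ltn_sorted_uniq_leq sort_uniq fset_uniq.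
    exact: (sort_sorted leq_total).
  by rewrite size_sort; apply/card_eq_fsetP; rewrite -eF.
rewrite (gridded_class_eq (gridded_eq_sym SA)) /points.
congr (gridded_class _); rewrite eS eF; congr (p @` _).
by apply/seteqP; split=> i /=; rewrite mem_sort.
Qed.

Lemma level_points s : uniq s ->
  level (pin_class p) (size s) (gridded_class (points s)).
Proof.
move=> us; exists (points s) => //; split; last exact: card_points.
split; first exact: points_gridded_perm.
by exists (points s); [move=> _ [i _ <-]; exists i|exact: gridded_eq_refl].
Qed.

Lemma sub_level n : level (pin_class p) n `<=`
  [set` [seq gridded_class (points t) | t <- head_tails M hz n]].
Proof.
move=> C /level_pin_class[s [ss <-] ->].
have [t ht st] := head_tails_complete (X := X) (Y := Y) (q := q) (M := M)
  (hz := hz) tail_dom_far tail_neighbours (horizontalS hw) q_const ss.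
by apply/mapP; exists t => //; exact: gridded_class_eq (iso_gridded_eq st).
Qed.

Lemma finite_level n : finite_set (level (pin_class p) n).
Proof. by apply: sub_finite_set (@sub_level n) _; exact: finite_seq. Qed.

Lemma card_level_le n :
  (#|` fset_set (level (pin_class p) n)| <= size (head_tails M hz n))%N.
Proof.
rewrite -(size_map (fun t => gridded_class (points t))).
apply: leq_trans (size_undup _); rewrite -(size_seq_fset tt).
apply: fsubset_leq_card; apply/fsubsetP => C.
by rewrite in_fset_set ?inE; [move=> /sub_level; rewrite seq_fsetE|
  exact: finite_level].
Qed.

(** The class of a realized code determines its index set up to [iso], and this determines the
    code. *)
Lemma card_level_ge n :
  (size (codes n) <= #|` fset_set (level (pin_class p) n)|)%N.
Proof.
pose F c := gridded_class (points (realize hz M c)).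
have Fi : {in codes n &, injective F}.
  move=> c c' /codes_ok[ok _] /codes_ok[ok' _] e.
  apply: (realize_inj tail_dom_far tail_neighbours (horizontalS hw)
    (leqnn M) (leqnn M) ok ok').
  apply: gridded_eq_iso; try exact: uniq_realize.
  by apply: gridded_class_inj e; exact: points_gridded_perm.
rewrite -(size_map F); have uF : uniq (map F (codes n)).
  by rewrite map_inj_in_uniq // uniq_codes.
rewrite -(undup_id uF) -(size_seq_fset tt).
apply: fsubset_leq_card; apply/fsubsetP => C; rewrite seq_fsetE => /mapP[c cn ->].
rewrite in_fset_set ?inE; last exact: finite_level.
have [ok <-] := codes_ok cn; rewrite -(size_realize hz M c).
by apply: level_points; exact: uniq_realize.
Qed.
End PinTail.

(** * Growth rate *)

Section GrowthRate.
Variable R : realType.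

Lemma cvg_root_const (a : R) : 0 < a ->
  (fun n : nat => a `^ n%:R^-1) @ \oo --> (1 : R).
Proof.
move=> a0; have -> : (fun n : nat => a `^ n%:R^-1) =
    (fun n : nat => expR (n%:R^-1 * ln a)).
  by apply/funext => n; rewrite /powR gt_eqF.
rewrite -[X in _ --> X](expR0 R);
apply: (@continuous_cvg _ _ _ _ _ _ expR); first exact: continuous_expR.
rewrite -[X in _ --> X](mul0r (ln a)); apply: cvgM; last exact: cvg_cst.
by rewrite -cvg_shiftS; exact: cvg_harmonic.
Qed.

Lemma growth_squeeze (u : nat -> R) (a b k : R) : 0 < a -> 0 < b -> 0 < k ->
  (forall n, a * k ^+ n <= u n) -> (forall n, u n <= b * k ^+ n) ->
  (fun n : nat => u n `^ n%:R^-1) @ \oo --> k.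
Proof.
move=> a0 b0 k0 ua ub.
have root c : 0 < c -> (fun n : nat => c `^ n%:R^-1 * k) @ \oo --> k.
  move=> c0; rewrite -[X in _ --> X]mul1r; apply: cvgM; last exact: cvg_cst.
  exact: cvg_root_const.
have rootE c n : 0 < c -> (0 < n)%N -> (c * k ^+ n) `^ n%:R^-1 = c `^ n%:R^-1 * k.
  move=> c0 n0; rewrite powRM ?ltW ?exprn_gt0 // -powR_mulrn ?ltW // -powRrM.
  by rewrite mulfV ?powRr1 ?ltW // pnatr_eq0 -lt0n.
apply: squeeze_cvgr (root _ a0) (root _ b0).
(* At [n = 0] the exponent is 0 and [rootE] does not apply. *)
exists 1%N => // n /= n0.
rewrite -!rootE //; apply/andP; split; apply: ge0_ler_powR;
  rewrite ?nnegrE ?invr_ge0 ?ler0n ?ua ?ub //.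
- by rewrite mulr_ge0 ?exprn_ge0 ?ltW.
- by apply: le_trans (ua n); rewrite mulr_ge0 ?exprn_ge0 ?ltW.
- by apply: le_trans (ua n); rewrite mulr_ge0 ?exprn_ge0 ?ltW.
- by rewrite mulr_ge0 ?exprn_ge0 ?ltW.
Qed.

Lemma root_kappaE (x : R) :
  root ('X^3 - 2 *: 'X^2 - 1) x = (x ^+ 3 == 2 * x ^+ 2 + 1).
Proof.
by rewrite -[RHS]subr_eq0 /root !hornerE; congr (_ == 0); ring.
Qed.

(** Intermediate value theorem on the interval of radius 0.000005 around 2.20557, written digit by
    digit. *)
Lemma kappa_exists : exists2 k : R, k ^+ 3 = 2 * k ^+ 2 + 1 &
  `|k - (2 + 2 / 10 + 5 / 10 ^+ 3 + 5 / 10 ^+ 4 + 7 / 10 ^+ 5)| <= 5 / 10 ^+ 6.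
Proof.
pose c : R := 2 + 2 / 10 + 5 / 10 ^+ 3 + 5 / 10 ^+ 4 + 7 / 10 ^+ 5.
pose e : R := 5 / 10 ^+ 6.
have e0 : 0 < e by rewrite divr_gt0 ?exprn_gt0.
have pE x : ('X^3 - 2 *: 'X^2 - 1 : {poly R}).[x] = x ^+ 3 - 2 * x ^+ 2 - 1.
  by rewrite !hornerE; ring.
have [||k hk rk] := @poly_ivt R ('X^3 - 2 *: 'X^2 - 1) (c - e) (c + e).
- by lra.
- by rewrite !pE /c /e; apply/andP; split; lra.
exists k; first by apply/eqP; rewrite -root_kappaE.
by rewrite -/c -/e ler_distl.
Qed.
End GrowthRate.

Theorem theorem3p8 (R : realType) (w : nat -> letter) (p : nat -> R * R)
    (hw : infinite_pin_word w) (hvisits : finite_set (visits w))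
    (hp : pin_points w p) :
  exists kappa : R,
    [/\ root ('X^3 - 2 *: 'X^2 - 1) kappa,
        forall x : R, root ('X^3 - 2 *: 'X^2 - 1) x -> x <= kappa,
        `|kappa - (2 + 2 / 10 + 5 / 10 ^+ 3 + 5 / 10 ^+ 4 + 7 / 10 ^+ 5)|
          <= 5 / 10 ^+ 6 &
        has_growth_rate (pin_class p) kappa].
Proof.
have [k ek kc] := kappa_exists R.
have [M hM] := eventually_const_quadrant hvisits.
have kb : 2 <= k <= 3 by move: kc; rewrite ler_norml; lra.
exists k; split.
- by rewrite root_kappaE ek.
- move=> x; rewrite root_kappaE => /eqP ex; rewrite leNgt; apply/negP => kx.
  (* Subtracting the two cubic equations leaves the factor [x - k]; the cofactor is positive for
     [2 <= k < x]. *)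
  have : (x - k) * (x ^+ 2 + x * k + k ^+ 2 - 2 * x - 2 * k) = 0.
    rewrite (_ : _ * _ = (x ^+ 3 - 2 * x ^+ 2) - (k ^+ 3 - 2 * k ^+ 2)); last by ring.
    by rewrite ex ek; ring.
  apply/eqP; rewrite gt_eqF // mulr_gt0 ?subr_gt0 //; move: kb kx => /andP[k2 _] kx.
  by clear -k2 kx; nra.
- exact: kc.
(* The lower constant is that of [size_codes_ge]; the upper one counts the initial subsets, with one
   more [k] from the exponent [n.+1]. *)
apply: (@growth_squeeze _ _ 11^-1 (#|{: M.-tuple bool}|%:R * k)).
- by lra.
- by rewrite mulr_gt0 // ?ltr0n; [apply/card_gt0P; exists [tuple of nseq M true]|lra].
- by lra.
- move=> n; have := size_codes_ge ek kb n.
  have : (size (codes n))%:R <= #|` fset_set (level (pin_class p) n)|%:R :> R.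
    by rewrite ler_nat (card_level_ge hw hp hM).
  lra.
- move=> n; rewrite -mulrA -exprS.
  apply: le_trans (size_head_tails_le ek kb M _ n).
  by rewrite ler_nat; exact: (card_level_le hw hp hM).
Qed.
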